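(* Let $\mathcal{G}$ be a CGS, $s\in\mathrm{St}$ one of its states, $\varphi$ an NGSL formula in positive normal form, and $\chi$ an $s$-total assignment with $\mathrm{free}(\varphi)\subseteq\mathrm{dom}(\chi)$. Then $\mathcal{G},\chi,s\models_E\varphi$ implies $\mathcal{G},\chi,s\models\varphi$.
   Context: A CGS is $\langle \mathrm{AP}, \mathrm{Ag}, \mathrm{Ac}, \mathrm{St}, \lambda, \tau, s_0\rangle$ (finite non-empty atomic propositions and agents, non-empty actions and states, initial state, $\lambda:\mathrm{St}\to2^{\mathrm{AP}}$, $\tau:\mathrm{St}\times\mathrm{Ac}^{\mathrm{Ag}}\to\mathrm{St}$). Tracks: finite non-empty state sequences with consecutive states $\tau$-related under some decision; $\mathrm{Trk}(s)$ those starting at $s$. Strategies: partial maps tracks$\to\mathrm{Ac}$; $\mathrm{Str}(s)=\mathrm{Trk}(s)\to\mathrm{Ac}$ ($s$-total strategies). Assignments: partial maps $\mathrm{Var}\cup\mathrm{Ag}\to$ strategies; $s$-total if all values are in $\mathrm{Str}(s)$; complete if defined on all agents; $\mathrm{Asg}(X,s)=X\to\mathrm{Str}(s)$. Translation $(f)_\rho(\rho')=f(\rho\cdot\rho'_{\ge1})$; $\mathrm{play}(\chi,s)$ is the path $\pi$ with $\pi_0=s$, $\pi_{i+1}=\tau(\pi_i,d_i)$, $d_i(a)=\chi(a)(\pi_0\cdots\pi_i)$; $(\chi,s)^i=((\chi)_{\pi_0\cdots\pi_i},\pi_i)$. SL: $\varphi ::= p\mid\neg\varphi\mid\varphi\wedge\varphi\mid\varphi\vee\varphi\mid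 X\varphi\mid\varphi U\varphi\mid\varphi R\varphi\mid\langle\langle x\rangle\rangle\varphi\mid[[x]]\varphi\mid(a,x)\varphi$; free agents/variables: atoms none; Boolean union; $X,U,R$ add all agents; quantifiers on $x$ remove $x$; $(a,x)\varphi$: $\mathrm{free}(\varphi)$ if $a\notin\mathrm{free}(\varphi)$, else $(\mathrm{free}(\varphi)\setminus\{a\})\cup\{x\}$. Classical semantics $\models$: $p$ iff $p\in\lambda(s)$; Boolean usual; $\langle\langle x\rangle\rangle\varphi$/$[[x]]\varphi$: some/all $f\in\mathrm{Str}(s)$ satisfy $\mathcal{G},\chi[x\mapsto f],s\models\varphi$; $(a,x)\varphi$ iff $\mathcal{G},\chi[a\mapsto\chi(x)],s\models\varphi$; $X,U,R$ for complete $\chi$ as in LTL along $(\chi,s)^i$. Positive normal form: negation applied only to atomic propositions. Quantification prefix over finite $V\subseteq\mathrm{Var}$: word over $\{\langle\langle x\rangle\rangle,[[x]]:x\in V\}$ with each $x\in V$ exactly once ($\mathrm{Qnt}(V)$); $\mathcal{E}(\wp),\mathcal{U}(\wp)$ existential/universal variables; $\mathrm{Dep}(\wp,y)$ the universal variables before existential $y$. Binding prefix: word of length $|\mathrm{Ag}|$ over pairs $(a,x)$ with each agent exactly once. NGSL: $\varphi ::= p\mid\neg\varphi\mid\varphi\wedge\varphi\mid\varphi\vee\varphi\mid X\varphi\mid\varphi U\varphi\mid\varphi R\varphi\mid\wp\varphi\mid\flat\varphi$, with $\flat$ a binding prefix, and in $\wp\varphi$, $\varphi$ agent-closed and $\wp\in\mathrm{Qnt}(\mathrm{free}(\varphi))$.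 $\mathrm{Val}_D(W)=W\to D$. A dependence map for $\wp$ over $D$ is $\theta:\mathrm{Val}_D(\mathcal{U}(\wp))\to\mathrm{Val}_D(V)$ with $\theta(v)|_{\mathcal{U}(\wp)}=v$ and, for $x\in\mathcal{E}(\wp)$, $\theta(v_1)(x)=\theta(v_2)(x)$ whenever $v_1,v_2$ agree on $\mathrm{Dep}(\wp,x)$. For $D=T\to D'$, a dependence map $\theta$ is elementary if there is $\tilde\theta:T\to(\mathrm{Val}_{D'}(\mathcal{U}(\wp))\to\mathrm{Val}_{D'}(V))$ with $\tilde\theta(t)(\hat g(t))(x)=\theta(g)(x)(t)$ for all $g$, $x$, $t$, where $\hat g(t)(u)=g(u)(t)$; elementary dependence maps over $\mathrm{Str}(s)=\mathrm{Trk}(s)\to\mathrm{Ac}$ are taken with $T=\mathrm{Trk}(s)$, $D'=\mathrm{Ac}$. Elementary semantics $\models_E$: defined like $\models$ for atoms, Boolean connectives, temporal operators and bindings, while a subformula $\wp\psi$ ($\psi$ agent-closed, $\wp\in\mathrm{Qnt}(\mathrm{free}(\psi))$) is evaluated with the empty assignment: $\mathcal{G},\emptyset,s\models_E\wp\psi$ iff there is an elementary dependence map $\theta$ for $\wp$ over $\mathrm{Str}(s)$ such that $\mathcal{G},\theta(\chi),s\models_E\psi$ for all $\chi\in\mathrm{Asg}(\mathcal{U}(\wp),s)$. *)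

(* Defs.v *)
From HB Require Import structures.
From mathcomp Require Import all_boot.

Set Implicit Arguments.
Unset Strict Implicit.
Unset Printing Implicit Defensive.

Record CGS := MkCGS {
  AP : finType;
  Ag : finType;
  Ac : Type;
  St : Type;
  lab : St -> {set AP};
  trans : St -> (Ag -> Ac) -> St;
  init : St;
  AP_inh : inhabited AP;
  Ag_inh : inhabited Ag;
  Ac_inh : inhabited Ac
}.

Section Tracks.
Variable G : CGS.

Definition step (s t : St G) : Prop := exists d : Ag G -> Ac G, t = trans s d.

Fixpoint chain (s : St G) (r : seq (St G)) : Prop :=
  if r is t :: r' then step s t /\ chain t r' else True.

Definition is_track (r : seq (St G)) : Prop :=
  if r is s :: r' then chain s r' else False.

Definition Trk (s : St G) : Type :=
  {r : seq (St G) | is_track r /\ ohead r = Some s}.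

Definition lst (s : St G) (r : Trk s) : St G := last s (sval r).

Definition Str (s : St G) : Type := Trk s -> Ac G.

Lemma chain_cat s r1 r2 :
  chain s (r1 ++ r2) <-> chain s r1 /\ chain (last s r1) r2.
Proof.
elim: r1 s => [|t r1 IH] s /=; first by split=> [|[]].
by have [H1 H2] := IH t; split=> [[? /H1[]]|[[? ?] ?]] //; split=> //; apply: H2.
Qed.

Lemma trk1P (s : St G) : is_track [:: s] /\ ohead [:: s] = Some s.
Proof. by []. Qed.

Definition trk1 (s : St G) : Trk s := exist _ [:: s] (trk1P s).

Lemma trk_extP (s : St G) (r : Trk s) (d : Ag G -> Ac G) :
  let r' := rcons (sval r) (trans (lst r) d) in
  is_track r' /\ ohead r' = Some s.
Proof.
rewrite /lst; case: r => -[|t r] /= [tr hd] //; case: hd => <-; split=> //.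
rewrite -cats1; apply/chain_cat; split=> //=.
by split=> //; exists d.
Qed.

Definition trk_ext (s : St G) (r : Trk s) (d : Ag G -> Ac G) : Trk s :=
  exist _ (rcons (sval r) (trans (lst r) d)) (trk_extP r d).

Lemma trk_catP (s : St G) (r : Trk s) (r' : Trk (lst r)) :
  let r'' := sval r ++ behead (sval r') in
  is_track r'' /\ ohead r'' = Some s.
Proof.
rewrite /lst in r' *; case: r r' => -[|t r] /= [tr hd] // [[|u r'] /= [tr' hd']] //.
split=> //; apply/chain_cat; split=> //.
by case: hd' tr' => ->.
Qed.

Definition trk_cat (s : St G) (r : Trk s) (r' : Trk (lst r)) : Trk s :=
  exist _ (sval r ++ behead (sval r')) (trk_catP r').

Definition translate (s : St G) (f : Str s) (r : Trk s) : Str (lst r) :=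
  fun r' => f (trk_cat r').

End Tracks.
Arguments translate {G s} f r.

Section Assignments.
Variables (Var : eqType) (G : CGS).

(* The s-total assignments; [None] means undefined. *)
Definition Asg (s : St G) : Type := (Var + Ag G)%type -> option (Str s).

Definition upd (s : St G) (chi : Asg s) (z : (Var + Ag G)%type)
    (o : option (Str s)) : Asg s :=
  fun z' => if z' == z then o else chi z'.

Definition asg_translate (s : St G) (chi : Asg s) (r : Trk s) : Asg (lst r) :=
  fun z => omap (fun f => translate f r) (chi z).

Definition complete (s : St G) (chi : Asg s) : Prop :=
  forall a : Ag G, isSome (chi (inr a)).

Definition oget (T : Type) (o : option T) : isSome o -> T :=
  match o return isSome o -> T with
  | Some v => fun _ => v
  | None => fun h => False_rect T (notF h)
  end.

(* The prefix pi_0 ... pi_i of the play of a complete assignment from s. *)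
Fixpoint play_prefix (s : St G) (chi : Asg s) (c : complete chi) (i : nat) :
    Trk s :=
  if i is j.+1 then
    trk_ext (play_prefix c j) (fun a => oget (c a) (play_prefix c j))
  else trk1 s.

Definition play (s : St G) (chi : Asg s) (c : complete chi) (i : nat) : St G :=
  lst (play_prefix c i).

Definition asg_at (s : St G) (chi : Asg s) (c : complete chi) (i : nat) :
    Asg (play c i) :=
  asg_translate chi (play_prefix c i).

Lemma play_prefixE (s : St G) (chi : Asg s) (c : complete chi) i :
  sval (play_prefix c i) = mkseq (play c) i.+1.
Proof.
elim: i => [//|i IH].
by rewrite mkseqS -IH /play /lst /= last_rcons.
Qed.

Lemma playS (s : St G) (chi : Asg s) (c : complete chi) i :
  play c i.+1 = trans (play c i) (fun a => oget (c a) (play_prefix c i)).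
Proof. by rewrite {1}/play /lst /= last_rcons. Qed.

End Assignments.

Inductive SL (Var AP Ag : Type) : Type :=
| SAtom of AP
| SNot of SL Var AP Ag
| SAnd of SL Var AP Ag & SL Var AP Ag
| SOr of SL Var AP Ag & SL Var AP Ag
| SNext of SL Var AP Ag
| SUntil of SL Var AP Ag & SL Var AP Ag
| SRelease of SL Var AP Ag & SL Var AP Ag
| SEx of Var & SL Var AP Ag
| SAll of Var & SL Var AP Ag
| SBind of Ag & Var & SL Var AP Ag.
Arguments SAtom {Var AP Ag}.

Section SLTheory.
Variables (Var Ag : eqType).

Definition is_agent (z : (Var + Ag)%type) : bool := if z is inr _ then true else false.

Fixpoint free (AP : Type) (phi : SL Var AP Ag) (z : (Var + Ag)%type) : bool :=
  match phi with
  | SAtom _ => false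
  | SNot f => free f z
  | SAnd f g | SOr f g => free f z || free g z
  | SNext f => is_agent z || free f z
  | SUntil f g | SRelease f g => [|| is_agent z, free f z | free g z]
  | SEx x f | SAll x f => free f z && (z != inl x)
  | SBind a x f =>
      if free f (inr a) then (free f z && (z != inr a)) || (z == inl x)
      else free f z
  end.

Definition agent_closed (AP : Type) (phi : SL Var AP Ag) : Prop :=
  forall a : Ag, ~~ free phi (inr a).

End SLTheory.

Fixpoint pnf (Var AP Ag : Type) (phi : SL Var AP Ag) : Prop :=
  match phi with
  | SAtom _ => True
  | SNot f => if f is SAtom _ then True else False
  | SAnd f g | SOr f g | SUntil f g | SRelease f g => pnf f /\ pnf g
  | SNext f | SEx _ f | SAll _ f | SBind _ _ f => pnf f
  end.

(* Temporal operators are meaningful only under complete assignments; under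
   incomplete ones they are set to False. Since they have all agents free, this
   default is never met when the free placeholders lie in the domain of chi. *)
Fixpoint sat (Var : eqType) (G : CGS) (phi : SL Var (AP G) (Ag G)) :
    forall s : St G, Asg Var s -> Prop :=
  match phi with
  | SAtom p => fun s _ => p \in lab s
  | SNot f => fun s chi => ~ sat f chi
  | SAnd f g => fun s chi => sat f chi /\ sat g chi
  | SOr f g => fun s chi => sat f chi \/ sat g chi
  | SNext f => fun s chi => exists c : complete chi, sat f (asg_at c 1)
  | SUntil f g => fun s chi => exists c : complete chi,
      exists2 i, sat g (asg_at c i) & forall j, j < i -> sat f (asg_at c j)
  | SRelease f g => fun s chi => exists c : complete chi,
      forall i, sat g (asg_at c i) \/ exists2 j, j < i & sat f (asg_at c j)
  | SEx x f => fun s chi => exists h : Str s, sat f (upd chi (inl x) (Some h))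
  | SAll x f => fun s chi => forall h : Str s, sat f (upd chi (inl x) (Some h))
  | SBind a x f => fun s chi => sat f (upd chi (inr a) (chi (inl x)))
  end.

Variant quant : Type := Qex | Qall.

Definition is_all (q : quant) : bool := if q is Qall then true else false.

Section Prefixes.
Variable Var : eqType.

Definition qprefix := seq (quant * Var).

Definition qvars (w : qprefix) : seq Var := unzip2 w.
Definition qex (w : qprefix) : seq Var := [seq qx.2 | qx <- w & ~~ is_all qx.1].
Definition quniv (w : qprefix) : seq Var := [seq qx.2 | qx <- w & is_all qx.1].
Definition qdep (w : qprefix) (y : Var) : seq Var :=
  quniv (take (index y (qvars w)) w).

Definition is_qnt (w : qprefix) (V : pred Var) : Prop :=
  uniq (qvars w) /\ forall x, (x \in qvars w) = V x.

Definition is_bnd (Ag : finType) (b : seq (Ag * Var)) : Prop :=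
  size b = #|Ag| /\ forall a : Ag, count_mem a (unzip1 b) = 1.

Definition Val (D : Type) (W : seq Var) : Type := {x : Var | x \in W} -> D.

Definition dependence_map (D : Type) (w : qprefix)
    (theta : Val D (quniv w) -> Val D (qvars w)) : Prop :=
  (forall v (u : {x | x \in quniv w}) (x : {x | x \in qvars w}),
     sval x = sval u -> theta v x = v u) /\
  (forall v1 v2 (x : {x | x \in qvars w}), sval x \in qex w ->
     (forall u : {x | x \in quniv w}, sval u \in qdep w (sval x) -> v1 u = v2 u) ->
     theta v1 x = theta v2 x).

Definition flip_val (T D : Type) (W : seq Var) (g : Val (T -> D) W) (t : T) :
    Val D W :=
  fun u => g u t.

Definition elementary (T D : Type) (w : qprefix)
    (theta : Val (T -> D) (quniv w) -> Val (T -> D) (qvars w)) : Prop :=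
  exists adj : T -> Val D (quniv w) -> Val D (qvars w),
    forall g x t, adj t (flip_val g t) x = theta g x t.

End Prefixes.

Inductive NGSL (Var AP Ag : Type) : Type :=
| NAtom of AP
| NNot of NGSL Var AP Ag
| NAnd of NGSL Var AP Ag & NGSL Var AP Ag
| NOr of NGSL Var AP Ag & NGSL Var AP Ag
| NNext of NGSL Var AP Ag
| NUntil of NGSL Var AP Ag & NGSL Var AP Ag
| NRelease of NGSL Var AP Ag & NGSL Var AP Ag
| NQnt of seq (quant * Var) & NGSL Var AP Ag
| NBnd of seq (Ag * Var) & NGSL Var AP Ag.
Arguments NAtom {Var AP Ag}.

Fixpoint SL_of (Var AP Ag : Type) (phi : NGSL Var AP Ag) : SL Var AP Ag :=
  match phi with
  | NAtom p => SAtom p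
  | NNot f => SNot (SL_of f)
  | NAnd f g => SAnd (SL_of f) (SL_of g)
  | NOr f g => SOr (SL_of f) (SL_of g)
  | NNext f => SNext (SL_of f)
  | NUntil f g => SUntil (SL_of f) (SL_of g)
  | NRelease f g => SRelease (SL_of f) (SL_of g)
  | NQnt w f =>
      foldr (fun qx h => if is_all qx.1 then SAll qx.2 h else SEx qx.2 h) (SL_of f) w
  | NBnd b f => foldr (fun ax h => SBind ax.1 ax.2 h) (SL_of f) b
  end.

(* The side conditions of the grammar, which [NGSL] itself does not enforce. *)
Fixpoint ngsl_wf (Var : eqType) (AP : Type) (Ag : finType) (phi : NGSL Var AP Ag) :
    Prop :=
  match phi with
  | NAtom _ => True
  | NNot f | NNext f => ngsl_wf f
  | NAnd f g | NOr f g | NUntil f g | NRelease f g => ngsl_wf f /\ ngsl_wf g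
  | NQnt w f =>
      [/\ ngsl_wf f, agent_closed (SL_of f)
        & is_qnt w (fun x => free (SL_of f) (inl x))]
  | NBnd b f => ngsl_wf f /\ is_bnd b
  end.

Definition asg_of_val (Var : eqType) (G : CGS) (s : St G) (W : seq Var)
    (v : Val (Str s) W) : Asg Var s :=
  fun z => if z is inl x then omap v (insub x) else None.

Definition bind_asg (Var : eqType) (G : CGS) (s : St G) (chi : Asg Var s)
    (b : seq (Ag G * Var)) : Asg Var s :=
  foldl (fun chi' ax => upd chi' (inr ax.1) (chi' (inl ax.2))) chi b.

(* The clause for [NQnt] discards the current assignment: its argument is a
   sentence, evaluated under the empty assignment. *)
Fixpoint satE (Var : eqType) (G : CGS) (phi : NGSL Var (AP G) (Ag G)) :
    forall s : St G, Asg Var s -> Prop :=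
  match phi with
  | NAtom p => fun s _ => p \in lab s
  | NNot f => fun s chi => ~ satE f chi
  | NAnd f g => fun s chi => satE f chi /\ satE g chi
  | NOr f g => fun s chi => satE f chi \/ satE g chi
  | NNext f => fun s chi => exists c : complete chi, satE f (asg_at c 1)
  | NUntil f g => fun s chi => exists c : complete chi,
      exists2 i, satE g (asg_at c i) & forall j, j < i -> satE f (asg_at c j)
  | NRelease f g => fun s chi => exists c : complete chi,
      forall i, satE g (asg_at c i) \/ exists2 j, j < i & satE f (asg_at c j)
  | NQnt w f => fun s _ =>
      exists theta : Val (Str s) (quniv w) -> Val (Str s) (qvars w),
        [/\ dependence_map theta, elementary theta
          & forall v : Val (Str s) (quniv w), satE f (asg_of_val (theta v))]
  | NBnd b f => fun s chi => satE f (bind_asg chi b)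
  end.

(* Main.v *)
Require Import Defs.
From HB Require Import structures.
From mathcomp Require Import all_boot.
From Stdlib Require Import FunctionalExtensionality.

(** Induction on the formula; positive normal form makes every connective
    monotone. For a quantification prefix, a dependence map [theta] acts as a
    simultaneous Skolem function: reading the prefix from left to right, universal
    choices are stored in a valuation [v] and each existential variable [x] gets
    [theta v x], which later universal choices do not alter. At the end the
    current assignment agrees with [theta v] on the free placeholders of the
    matrix, and satisfaction depends on nothing else. *)

Lemma oget_eq (T : Type) (o1 o2 : option T) (h1 : isSome o1)
    (h2 : isSome o2) : o1 = o2 -> oget h1 = oget h2.
Proof. by move=> E; case: o2 / E h2; case: o1 h1. Qed.

Section Coincidence.
Variables (Var : eqType) (G : CGS).

Lemma play_prefix_agree (s : St G) (chi1 chi2 : Asg Var s)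
    (c1 : complete chi1) (c2 : complete chi2) i :
  (forall a, chi1 (inr a) = chi2 (inr a)) -> play_prefix c1 i = play_prefix c2 i.
Proof.
move=> E; elim: i => //= i ->; congr trk_ext.
by apply: functional_extensionality => a; rewrite (oget_eq _ _ _ (c1 a) (c2 a)).
Qed.

(** The types of [asg_at c1 i] and [asg_at c2 i] depend on the two plays, so these assignments are
    comparable only once the plays are identified. The abstract [P] lets each induction hypothesis
    of a temporal operator be moved along the play. *)
Lemma asg_at_transport (P : forall s : St G, Asg Var s -> Prop)
    (A : (Var + Ag G)%type -> bool) :
  (forall (s : St G) (chi1 chi2 : Asg Var s),
     (forall z, A z -> chi1 z = chi2 z) -> P s chi1 -> P s chi2) ->
  forall (s : St G) (chi1 chi2 : Asg Var s) (c1 : complete chi1)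
    (c2 : complete chi2) i,
  (forall z, is_agent z || A z -> chi1 z = chi2 z) ->
  P _ (asg_at c1 i) -> P _ (asg_at c2 i).
Proof.
move=> PA s chi1 chi2 c1 c2 i E; rewrite /asg_at /play.
rewrite (play_prefix_agree s chi1 chi2 c1 c2) => [|a]; last exact: E.
by apply: PA => z Az; rewrite /asg_translate E // Az orbT.
Qed.

Lemma complete_agree (s : St G) (chi1 chi2 : Asg Var s) :
  (forall a, chi1 (inr a) = chi2 (inr a)) -> complete chi1 -> complete chi2.
Proof. by move=> E c a; rewrite -E. Qed.

Lemma sat_agree (phi : SL Var (AP G) (Ag G)) (s : St G) (chi1 chi2 : Asg Var s) :
  (forall z, free phi z -> chi1 z = chi2 z) -> sat phi chi1 -> sat phi chi2.
Proof.
elim: phi s chi1 chi2 => /= [p|f IHf|f IHf g IHg|f IHf g IHg|f IHf|f IHf g IHg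
    |f IHf g IHg|x f IHf|x f IHf|a x f IHf] s chi1 chi2 E //.
(* Negation uses the induction hypothesis with the two assignments exchanged. *)
- by move=> H1 H2; apply: H1; apply: IHf H2 => z /E.
- case=> H1 H2; split; first by apply: IHf H1 => z Hz; apply: E; rewrite Hz.
  by apply: IHg H2 => z Hz; apply: E; rewrite Hz orbT.
- case=> H; first by left; apply: IHf H => z Hz; apply: E; rewrite Hz.
  by right; apply: IHg H => z Hz; apply: E; rewrite Hz orbT.
- have Ea a : chi1 (inr a) = chi2 (inr a) by apply: E.
  case=> c H; exists (complete_agree _ _ _ Ea c).
  exact: (asg_at_transport _ _ IHf) H.
- have Ea a : chi1 (inr a) = chi2 (inr a) by apply: E.
  have Ef z : is_agent z || free f z -> chi1 z = chi2 z.
    by move=> /orP[]H; apply: E; rewrite H ?orbT.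
  have Eg z : is_agent z || free g z -> chi1 z = chi2 z.
    by move=> /orP[]H; apply: E; rewrite H ?orbT.
  case=> c [i Hg Hf]; exists (complete_agree _ _ _ Ea c), i.
    exact: (asg_at_transport _ _ IHg) Hg.
  by move=> j /Hf; apply: (asg_at_transport _ _ IHf).
- have Ea a : chi1 (inr a) = chi2 (inr a) by apply: E.
  have Ef z : is_agent z || free f z -> chi1 z = chi2 z.
    by move=> /orP[]H; apply: E; rewrite H ?orbT.
  have Eg z : is_agent z || free g z -> chi1 z = chi2 z.
    by move=> /orP[]H; apply: E; rewrite H ?orbT.
  case=> c H; exists (complete_agree _ _ _ Ea c) => i.
  case: (H i) => [Hg|[j ji Hf]]; [left|right; exists j => //].
    exact: (asg_at_transport _ _ IHg) Hg.
  exact: (asg_at_transport _ _ IHf) Hf.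
- case=> h H; exists h; apply: IHf H => z Hz; rewrite /upd.
  by case: eqP => // /eqP zx; apply: E; rewrite Hz.
- move=> H h; apply: IHf (H h) => z Hz; rewrite /upd.
  by case: eqP => // /eqP zx; apply: E; rewrite Hz.
(* If [z] is the bound agent, both updates read [x], which is free in the binding because the agent
   is free in [f]. *)
- apply: IHf => z Hz; rewrite /upd; case: eqP => [za|/eqP za]; apply: E.
    by rewrite -za Hz eqxx orbT.
  by case: ifP; rewrite Hz ?za.
Qed.

End Coincidence.

Section Prefixes.
Variable Var : eqType.

Lemma qvarsP (w : qprefix Var) x :
  (x \in qvars w) = (x \in qex w) || (x \in quniv w).
Proof.
rewrite /qvars /qex /quniv /unzip2.
by elim: w => // -[[] y] w /= IH; rewrite !inE IH; [rewrite orbA | rewrite orbCA].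
Qed.

Lemma quniv_qvars (w : qprefix Var) : {subset quniv w <= qvars w}.
Proof. by move=> x; rewrite qvarsP orbC => ->. Qed.

(** The first occurrence of [x] lies in [w1], so the cut defining [qdep] never reaches [w2]. *)
Lemma qdep_cat (w1 w2 : qprefix Var) x :
  x \in qvars w1 -> {subset qdep (w1 ++ w2) x <= qvars w1}.
Proof.
move=> xw1 y; rewrite /qdep /qvars /unzip2 map_cat index_cat xw1 => /quniv_qvars.
have lt_x : index x (qvars w1) <= size w1.
  by rewrite -(size_map (@snd _ _) w1) index_size.
by rewrite takel_cat // /qvars /unzip2 map_take => /mem_take.
Qed.

(* No existential variable of [w1] depends on a universal variable outside it. *)
Lemma dependence_map_cat (D : Type) (w1 w2 : qprefix Var)
    (theta : Val D (quniv (w1 ++ w2)) -> Val D (qvars (w1 ++ w2))) v1 v2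
    (x : {x | x \in qvars (w1 ++ w2)}) :
  dependence_map theta -> sval x \in qvars w1 ->
  (forall u : {x | x \in quniv (w1 ++ w2)}, sval u \in qvars w1 -> v1 u = v2 u) ->
  theta v1 x = theta v2 x.
Proof.
case=> thU thE xw1 E; have := svalP x; rewrite {1}qvarsP => /orP[xe|xu].
  by apply: thE => // u /(qdep_cat _ _ _ xw1) /E.
by rewrite !(thU _ (exist _ (sval x) xu)) // E.
Qed.

End Prefixes.

Lemma pnf_foldr_quant (Var AP Ag : Type) (w : seq (quant * Var)) (f : SL Var AP Ag) :
  pnf (foldr (fun qx h => if is_all qx.1 then SAll qx.2 h else SEx qx.2 h) f w) ->
  pnf f.
Proof. by elim: w => // -[[] x] w. Qed.

Lemma asg_of_val_sub (Var : eqType) (G : CGS) (s : St G) (W : seq Var)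
    (v : Val (Str s) W) (x : {x | x \in W}) :
  asg_of_val v (inl (sval x)) = Some (v x).
Proof. by rewrite /= (valK x). Qed.

Lemma sat_foldr_quant (Var : eqType) (G : CGS) (s : St G) (f : SL Var (AP G) (Ag G))
    (w : qprefix Var) (theta : Val (Str s) (quniv w) -> Val (Str s) (qvars w))
    (chi : Asg Var s) :
  agent_closed f -> is_qnt w (fun x => free f (inl x)) -> dependence_map theta ->
  (forall v, sat f (asg_of_val (theta v))) ->
  sat (foldr (fun qx h => if is_all qx.1 then SAll qx.2 h else SEx qx.2 h) f w) chi.
Proof.
move=> fcl [uw wV] thD H.
(* Invariant: [w1] has been read and [chi] stores [theta v] on it; the values of [v] outside [w1]
   are provisional. *)
suff {chi} main w1 w2 : w = w1 ++ w2 -> forall (chi : Asg Var s) v,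
    (forall x : {x | x \in qvars w}, sval x \in qvars w1 ->
       chi (inl (sval x)) = Some (theta v x)) ->
    sat (foldr (fun qx h => if is_all qx.1 then SAll qx.2 h else SEx qx.2 h) f w2) chi.
  (* Before anything is read any valuation will do; an action supplies a constant one. *)
  have [a] := Ac_inh G.
  exact: (main [::] w erefl chi (fun _ _ => a)).
elim: w2 w1 => [|[q x] w2 IH] w1 Ew chi v Hv /=.
  apply: sat_agree (H v) => -[y|b]; last by rewrite (negbTE (fcl b)).
  move=> fy; have yw : y \in qvars w by rewrite wV.
  rewrite (asg_of_val_sub _ _ _ _ _ (exist _ y yw)) -(Hv (exist _ y yw)) //=.
  by move: yw; rewrite Ew cats0.
have xw : x \in qvars w by rewrite Ew /qvars /unzip2 map_cat mem_cat inE eqxx orbT.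
have xNw1 : x \notin qvars w1.
  move: uw; rewrite Ew /qvars /unzip2 map_cat cat_uniq /= => /and3P[_ + _].
  by rewrite negb_or => /andP[].
have Ew' : w = (rcons w1 (q, x)) ++ w2 by rewrite cat_rcons.
have in_rcons (y : Var) : y \in qvars (rcons w1 (q, x)) = (y == x) || (y \in qvars w1).
  by rewrite /qvars /unzip2 map_rcons mem_rcons inE.
case: q Ew Ew' in_rcons => Ew Ew' in_rcons /=.
  exists (theta v (exist _ x xw)); apply: (IH _ Ew' _ v) => y.
  rewrite in_rcons /upd; case: eqP => [yx _|yx /= yw1].
    by rewrite yx eqxx; congr (Some (theta v _)); apply: val_inj.
  by rewrite ifN ?Hv //; apply/eqP => -[].
(* The valuation changes at [x] only, and [x] is not in [w1] since the variables of [w] are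
   distinct; hence [theta] keeps its values on [w1]. *)
move=> h; pose v' : Val (Str s) (quniv w) := fun u => if sval u == x then h else v u.
apply: (IH _ Ew' _ v') => y; rewrite in_rcons /upd; case: eqP => [yx _|yx /= yw1].
  have xu : x \in quniv w.
    by rewrite Ew /quniv filter_cat map_cat mem_cat inE eqxx orbT.
  by rewrite yx eqxx (thD.1 _ (exist _ x xu)) // /v' /= eqxx.
rewrite ifN; last by apply/eqP => -[].
rewrite Hv //; congr Some; clear -Ew thD yw1 xNw1.
subst w; apply: (dependence_map_cat _ _ _ _ _ _ _ _ thD yw1) => u uw1.
by rewrite /v' ifN //; apply: contraNneq xNw1 => <-.
Qed.

(* [SL_of phi = SAtom p] does not force [phi = NAtom p]: empty quantification and
   binding prefixes leave no trace in [SL_of]. *)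
Lemma satE_SAtom (Var : eqType) (G : CGS) (phi : NGSL Var (AP G) (Ag G)) p
    (s : St G) (chi : Asg Var s) :
  SL_of phi = SAtom p -> p \in lab s -> satE phi chi.
Proof.
elim: phi s chi => //= [q|[|[[] x] w] f IH|[|ax b] f IH] s chi //=.
- by case=> ->.
(* Over the empty prefix both valuation types have the empty domain, so the identity typechecks and
   its conditions are vacuous. *)
- move=> Ef ps; exists id; split; last by move=> v; apply: IH.
    by split=> [v|v1 v2] [].
  by exists (fun _ => id).
- exact: IH.
Qed.

(** The outermost binding of the [foldr] is the first update of the [foldl] in [bind_asg]. *)
Lemma sat_foldr_bind (Var : eqType) (G : CGS) (s : St G) (b : seq (Ag G * Var))
    (f : SL Var (AP G) (Ag G)) (chi : Asg Var s) :
  sat (foldr (fun ax h => SBind ax.1 ax.2 h) f b) chi = sat f (bind_asg chi b).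
Proof. by elim: b chi => //= -[a x] b IH chi; rewrite IH. Qed.

Lemma pnf_foldr_bind (Var AP Ag : Type) (b : seq (Ag * Var)) (f : SL Var AP Ag) :
  pnf (foldr (fun ax h => SBind ax.1 ax.2 h) f b) -> pnf f.
Proof. by elim: b. Qed.

Lemma bind_asg_dom (Var : eqType) (G : CGS) (s : St G) (b : seq (Ag G * Var))
    (f : SL Var (AP G) (Ag G)) (chi : Asg Var s) :
  (forall z, free (foldr (fun ax h => SBind ax.1 ax.2 h) f b) z -> isSome (chi z)) ->
  forall z, free f z -> isSome (bind_asg chi b z).
Proof.
elim: b chi => //= -[a x] b IH chi /= H; apply: IH => z Hz; rewrite /upd.
case: eqP => [za|/eqP za]; apply: H; first by rewrite -za Hz eqxx orbT.
by case: ifP; rewrite Hz ?za.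
Qed.

Lemma asg_at_dom (Var : eqType) (G : CGS) (s : St G) (chi : Asg Var s)
    (c : complete chi) i z : isSome (chi z) -> isSome (asg_at c i z).
Proof. by rewrite /asg_at /asg_translate; case: (chi z). Qed.

Theorem theorem4p16 (Var : eqType) (G : CGS) (s : St G)
    (phi : NGSL Var (AP G) (Ag G)) (chi : Asg Var s) :
  ngsl_wf phi -> pnf (SL_of phi) ->
  (forall z : (Var + Ag G)%type, free (SL_of phi) z -> isSome (chi z)) ->
  satE phi chi -> sat (SL_of phi) chi.
Proof.
elim: phi s chi => /= [p|f _|f IHf g IHg|f IHf g IHg|f IHf|f IHf g IHg
    |f IHf g IHg|w f IHf|b f IHf] s chi //.
(* Under negation the implication is needed in the reverse direction, which positive normal form
   reduces to atoms. *)
- move=> _; case Ef: (SL_of f) => [p|||||||||] // _ _ nH ps; apply: nH.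
  exact: satE_SAtom Ef ps.
- move=> [wf wg] [pf pg] D [Hf Hg]; split.
    by apply: IHf => // z Hz; apply: D; rewrite Hz.
  by apply: IHg => // z Hz; apply: D; rewrite Hz orbT.
- move=> [wf wg] [pf pg] D [Hf|Hg]; [left|right].
    by apply: IHf => // z Hz; apply: D; rewrite Hz.
  by apply: IHg => // z Hz; apply: D; rewrite Hz orbT.
(* Both semantics follow the same play, so [c] is reused; translation along it preserves
   definedness. *)
- move=> wf pf D [c H]; exists c; apply: IHf => // z Hz.
  by apply/asg_at_dom/D; rewrite Hz orbT.
- move=> [wf wg] [pf pg] D [c [i Hg Hf]]; exists c, i.
    by apply: IHg => // z Hz; apply/asg_at_dom/D; rewrite Hz !orbT.
  by move=> j ji; apply: IHf (Hf j ji) => // z Hz; apply/asg_at_dom/D; rewrite Hz !orbT.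
- move=> [wf wg] [pf pg] D [c H]; exists c => i.
  case: (H i) => [Hg|[j ji Hf]]; [left|right; exists j => //].
    by apply: IHg => // z Hz; apply/asg_at_dom/D; rewrite Hz !orbT.
  by apply: IHf => // z Hz; apply/asg_at_dom/D; rewrite Hz !orbT.
- move=> [wf fcl wV] /pnf_foldr_quant pf _ [theta [thD _ H]].
  (* The induction hypothesis applies for each [v]: the matrix is agent-closed and its free
     variables are those of [w], where [theta v] is defined. *)
  apply: (sat_foldr_quant _ _ _ _ _ theta) => // v; apply: IHf => // -[x|a] Hz.
    have xw : x \in qvars w by rewrite wV.2.
    by rewrite (asg_of_val_sub _ _ _ _ _ (exist _ x xw)).
  by rewrite (negbTE (fcl a)) in Hz.
- move=> [wf _] /pnf_foldr_bind pf D H; rewrite sat_foldr_bind.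
  by apply: IHf => //; apply: bind_asg_dom.
Qed.
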